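(* Let $K,N\ge1$, $M\ge KN$, and let $\mathbf H_1,\dots,\mathbf H_K\in\mathbb C^{N\times M}$ be such that the stacked $KN\times M$ matrix has full row rank. Let $\mu_1\ge\dots\ge\mu_K\ge0$ with $\sum_k\mu_k=1$. For positive semidefinite $N\times N$ matrices $\mathbf Q_1,\dots,\mathbf Q_K$ let $\mathbf A^{(0)}=\mathbf I_M$, $\mathbf A^{(k)}=\mathbf I_M+\sum_{j=1}^k\mathbf H_j^H\mathbf Q_j\mathbf H_j$, let $R(\mathbf Q_1,\dots,\mathbf Q_K)=\sum_{k=1}^K\mu_k\log_2\frac{|\mathbf A^{(k)}|}{|\mathbf A^{(k-1)}|}$, and $$\mathcal C_{\mathrm{DPC}}(\boldsymbol\mu,\mathbf H,P)=\max_{\mathbf Q_k\succeq0,\ \sum_k\mathrm{tr}(\mathbf Q_k)\le P}R(\mathbf Q_1,\dots,\mathbf Q_K).$$ Then the choice $\mathbf Q_k=\frac{\mu_kP}{N}\mathbf I_N$, $k=1,\dots,K$, asymptotically achieves the optimum at high SNR: $$\lim_{P\to\infty}\left[\mathcal C_{\mathrm{DPC}}(\boldsymbol\mu,\mathbf H,P)-R\!\left(\tfrac{\mu_1P}{N}\mathbf I_N,\dots,\tfrac{\mu_KP}{N}\mathbf I_N\right)\right]=0.$$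
   Context: $\mathcal C_{\mathrm{DPC}}(\boldsymbol\mu,\mathbf H,P)$ is the maximum weighted sum rate over the dirty-paper-coding capacity region of the MIMO broadcast channel with $M$ transmit antennas and $K$ users with $N$ antennas each (channels $\mathbf H_k$), unit noise and total power $P$, expressed via the dual multiple-access channel with covariances $\mathbf Q_k$ and user $k$ decoded in the presence of users $1,\dots,k-1$. *)

(* Defs.v *)
From HB Require Import structures.
From mathcomp Require Import all_boot all_order all_algebra.
From mathcomp Require Import complex.
From mathcomp Require Import all_classical all_reals all_analysis.
Set Implicit Arguments. Unset Strict Implicit. Unset Printing Implicit Defensive.
Import Order.TTheory GRing.Theory Num.Theory.
Import numFieldNormedType.Exports.
Local Open Scope ring_scope.
Local Open Scope classical_set_scope.

Section DPC.
Variable R : realType.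
Local Notation C := (R[i]).

Definition hadj m n (A : 'M[C]_(m, n)) : 'M[C]_(n, m) := (map_mx Num.conj A)^T.

(* positive semidefinite: v Q v^H >= 0 (in the order of C: real and >= 0) for all v *)
Definition psdmx n (Q : 'M[C]_n) : Prop :=
  forall v : 'rV[C]_n, 0 <= (v *m Q *m hadj v) 0 0.

Definition log2 (x : R) : R := ln x / ln 2.

(* A^(k) = I_M + sum_{j <= k} H_j^H Q_j H_j  (users 1..K are indexed 0..K-1;
   A^(k) sums the first k users) *)
Definition Amx K N M (H : 'I_K -> 'M[C]_(N, M)) (Q : 'I_K -> 'M[C]_N) (k : nat)
  : 'M[C]_M :=
  1%:M + \sum_(j < K | (j < k)%N) hadj (H j) *m Q j *m H j.

(* weighted sum rate R(Q_1,...,Q_K); determinants of positive definite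
   Hermitian matrices are positive reals, we take their real part *)
Definition rateDPC K N M (mu : 'I_K -> R) (H : 'I_K -> 'M[C]_(N, M))
  (Q : 'I_K -> 'M[C]_N) : R :=
  \sum_(k < K) mu k * log2 (complex.Re (\det (Amx H Q k.+1)) / complex.Re (\det (Amx H Q k))).

Definition feasibleDPC K N (P : R) (Q : 'I_K -> 'M[C]_N) : Prop :=
  (forall k, psdmx (Q k)) /\ \sum_(k < K) \tr (Q k) <= real_complex R P.

(* C_DPC(mu, H, P) = max over feasible covariances (attained; written as sup) *)
Definition capDPC K N M (mu : 'I_K -> R) (H : 'I_K -> 'M[C]_(N, M)) (P : R) : R :=
  sup [set r | exists Q : 'I_K -> 'M[C]_N, feasibleDPC P Q /\ r = rateDPC mu H Q].

Definition stackH K N M (H : 'I_K -> 'M[C]_(N, M)) : 'M[C]_(\sum_(k < K) N, M) :=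
  \mxcol_(k < K) H k.

End DPC.

(* Main.v *)
Require Import Defs.
From HB Require Import structures.
From mathcomp Require Import all_boot all_order all_algebra.
From mathcomp Require Import mxred spectral complex ring.
From mathcomp Require Import all_classical all_reals all_analysis.
Import Order.TTheory GRing.Theory Num.Theory.
Import numFieldNormedType.Exports.
Local Open Scope ring_scope.
Local Open Scope classical_set_scope.

(* Let [W] stack the channels of the first k users and [G = W W^H], which is
   positive definite.  With [Q = diag(Q_1, ..., Q_k)],
     |A^(k)| = |I + W^H Q W| = |G| |G^-1 + Q|.
   Hadamard's inequality bounds this above by [|G|] times the product of the
   [c + Q_ii], for any [c] dominating the diagonal of [G^-1]; if [Q] is diagonal
   and positive it is at least [|G| |Q|].  The rate is a combination of the
   [ln |A^(k)|] with the nonnegative weights [mu_k - mu_(k+1)], so the [ln |G|]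
   cancel between an arbitrary allocation and the proposed one, and summation by
   parts bounds the gap by the sum over k and i of
     mu_k * ln ((c + (Q_k)_ii) / (mu_k P / N)).
   By [ln y <= y - 1] and the trace constraint this is at most [K N^2 c / P]. *)

Section HighSNR.
Set Implicit Arguments. Unset Strict Implicit. Unset Printing Implicit Defensive.
Variable R : realType.
Local Notation C := (R[i]).

(** * Conjugate transpose, semidefinite and definite quadratic forms *)

Lemma hadjE m n (A : 'M[C]_(m, n)) i j : hadj A i j = (A j i)^*.
Proof. by rewrite !mxE. Qed.

Lemma hadjM m n p (A : 'M[C]_(m, n)) (B : 'M[C]_(n, p)) :
  hadj (A *m B) = hadj B *m hadj A.
Proof. by rewrite /hadj map_mxM trmx_mul. Qed.

Lemma hadjK m n (A : 'M[C]_(m, n)) : hadj (hadj A) = A.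
Proof. by apply/matrixP => i j; rewrite !hadjE conjCK. Qed.

(** Hermitian symmetry is not demanded separately: [0 < z] in C includes that z is real, and a form
    with only real values is Hermitian. *)
Definition pdmx n (A : 'M[C]_n) : Prop :=
  forall v : 'rV[C]_n, v != 0 -> 0 < (v *m A *m hadj v) 0 0.

Lemma pdmx_psd n (A : 'M[C]_n) : pdmx A -> psdmx A.
Proof.
move=> pA v; have [->|/pA/ltW//] := eqVneq v 0.
by rewrite !mul0mx mxE.
Qed.

Lemma pdmxD n (A B : 'M[C]_n) : pdmx A -> psdmx B -> pdmx (A + B).
Proof.
move=> pA pB v v0; rewrite mulmxDr mulmxDl mxE.
by rewrite ltr_pwDl ?pA ?pB.
Qed.

Lemma psdmx_congr n m (A : 'M[C]_n) (B : 'M[C]_(m, n)) :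
  psdmx A -> psdmx (B *m A *m hadj B).
Proof. by move=> pA v; have := pA (v *m B); rewrite hadjM !mulmxA. Qed.

Lemma pdmx_congr n m (A : 'M[C]_n) (B : 'M[C]_(m, n)) :
  row_free B -> pdmx A -> pdmx (B *m A *m hadj B).
Proof.
move=> fB pA v v0; have := pA (v *m B); rewrite hadjM !mulmxA; apply.
by rewrite mulmx_free_eq0.
Qed.

(** Diagonal entries are values of the form, so positivity passes to them. *)
Lemma quad_delta n (A : 'M[C]_n) i :
  ((delta_mx 0 i : 'rV_n) *m A *m hadj (delta_mx 0 i : 'rV_n)) 0 0 = A i i.
Proof.
rewrite -rowE mxE (bigD1 i)//= big1 ?addr0.
  by rewrite hadjE !mxE !eqxx conjC1 mulr1.
by move=> j ji; rewrite hadjE !mxE (negPf ji) andbF conjC0 mulr0.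
Qed.

Lemma psdmx_diag n (A : 'M[C]_n) i : psdmx A -> 0 <= A i i.
Proof. by move=> pA; rewrite -quad_delta; exact: pA. Qed.

Lemma delta_row_neq0 n (i : 'I_n) : delta_mx 0 i != 0 :> 'rV[C]_n.
Proof.
by apply/eqP => /matrixP/(_ 0 i)/eqP; rewrite !mxE !eqxx oner_eq0.
Qed.

Lemma pdmx_diag n (A : 'M[C]_n) i : pdmx A -> 0 < A i i.
Proof. by move=> pA; rewrite -quad_delta; exact/pA/delta_row_neq0. Qed.

Lemma pdmx1 n : pdmx (1%:M : 'M[C]_n).
Proof.
move=> v v0; rewrite mulmx1 mxE.
have [i vi] : exists i, v 0 i != 0.
  by apply/existsP; apply: contraNT v0 => /existsPn h; apply/eqP/rowP => i;
    rewrite mxE; apply/eqP/negPn/h.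
rewrite (bigD1 i)//= ltr_pwDl ?sumr_ge0// => [|j _]; rewrite hadjE.
  by rewrite lt_def mul_conjC_eq0 vi mul_conjC_ge0.
exact: mul_conjC_ge0.
Qed.

(** * Determinant inequalities for definite matrices *)

(* Schur triangularisation; it serves non-normal A, so that [psdmx] need not
   first be shown to imply Hermitian symmetry. *)
Lemma schur_quad n (A : 'M[C]_n) : exists u : 'I_n -> 'rV[C]_n,
  let t i := (u i *m A *m hadj (u i)) 0 0 in
  [/\ forall i, u i != 0, \det A = \prod_i t i, \tr A = \sum_i t i &
      \det (1%:M + A) = \prod_i (1 + t i)].
Proof.
(* [Schur] requires positive dimension; the empty matrix is treated apart. *)
case: n => [|n] in A *.
  exists (fun=> 0); split; first by case.
  - by rewrite det_mx00 big_ord0.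
  - by rewrite /mxtrace !big_ord0.
  - by rewrite det_mx00 big_ord0.
have [P uP] := Schur A (ltn0Sn n).
rewrite /similar_to /= conjymx//; set T := (P *m A *m _) => trT.
have PP : P *m hadj P = 1%:M.
  by move/unitarymxP: uP; rewrite /hadj map_trmx.
have PP' := mulmx1C PP.
have TE : T = P *m A *m hadj P by rewrite /T /hadj map_trmx.
exists (fun i => row i P) => /=.
have tE i : (row i P *m A *m hadj (row i P)) 0 0 = T i i.
  rewrite TE -(quad_delta (P *m A *m hadj P)) rowE hadjM !mulmxA//.
have AE : A = hadj P *m T *m P.
  by rewrite TE !mulmxA PP' mul1mx -mulmxA PP' mulmx1.
have dP : \det (hadj P) * \det P = 1 by rewrite -det_mulmx PP' det1.
have detc B : \det (hadj P *m B *m P) = \det B.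
  by rewrite !det_mulmx mulrAC dP mul1r.
split.
- move=> i; apply/eqP => r0; have := @delta_row_neq0 _ i.
  rewrite -[delta_mx 0 i]mulmx1 -PP mulmxA -rowE r0 mul0mx eqxx//.
- rewrite {1}AE detc det_trig//; apply: eq_bigr => i _; rewrite tE//.
- rewrite {1}AE mxtrace_mulC mulmxA PP mul1mx.
  by apply: eq_bigr => i _; rewrite tE.
have -> : 1%:M + A = hadj P *m (1%:M + T) *m P.
  by rewrite mulmxDr mulmx1 mulmxDl PP' -AE.
rewrite detc det_trig.
  by apply: eq_bigr => i _; rewrite tE !mxE eqxx.
apply/is_trig_mxP => i j ij; move/is_trig_mxP: trT => /(_ i j ij).
by rewrite !mxE => ->; rewrite addr0 -val_eqE (ltn_eqF ij).
Qed.

Lemma pdmx_det_gt0 n (A : 'M[C]_n) : pdmx A -> 0 < \det A.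
Proof.
move=> pA; have [u [u0 -> _ _]] := schur_quad A.
by apply: prodr_gt0 => i _; exact: pA.
Qed.

Lemma pdmx_unit n (A : 'M[C]_n) : pdmx A -> A \in unitmx.
Proof. by move=> /pdmx_det_gt0 h; rewrite unitmxE unitfE gt_eqF. Qed.

Lemma psdmx_det1D n (A : 'M[C]_n) : psdmx A -> 1 <= \det (1%:M + A).
Proof.
move=> pA; have [u [_ _ _ ->]] := schur_quad A.
have e1 : \prod_(i < n) (1 : C) = 1 by rewrite big1.
rewrite -[leLHS]e1.
by apply: ler_prod => i _; rewrite ler01 lerDl pA.
Qed.

Lemma hadj_diag n (d : 'rV[C]_n) : (forall i, 0 <= d 0 i) ->
  hadj (diag_mx d) = diag_mx d.
Proof.
move=> d0; apply/matrixP => i j; rewrite hadjE !mxE eq_sym.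
by case: eqVneq => [->|]; rewrite ?mulr0n ?conjC0// !mulr1n geC0_conj.
Qed.

(** With D the diagonal matrix, A + D = D^(1/2) (I + D^(-1/2) A D^(-1/2)) D^(1/2), and the middle
    factor has determinant at least 1. *)
Lemma psdmx_detD_diag n (A : 'M[C]_n) (d : 'rV[C]_n) :
  psdmx A -> (forall i, 0 < d 0 i) -> \prod_i d 0 i <= \det (A + diag_mx d).
Proof.
move=> pA d0.
pose s := \row_i sqrtC (d 0 i); pose r := \row_i (sqrtC (d 0 i))^-1.
have s0 i : sqrtC (d 0 i) != 0 by rewrite sqrtC_eq0 gt_eqF.
have rs : diag_mx r *m diag_mx s = 1%:M.
  rewrite mulmx_diag; apply/matrixP => i j; rewrite !mxE.
  by case: eqVneq => [->|]; rewrite ?mulr0n// !mulr1n mulVf.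
have sr := mulmx1C rs.
have ss : diag_mx s *m diag_mx s = diag_mx d.
  rewrite mulmx_diag; apply/matrixP => i j; rewrite !mxE.
  by case: eqVneq => [->|]; rewrite ?mulr0n// !mulr1n -expr2 sqrtCK.
have hr : hadj (diag_mx r) = diag_mx r.
  by apply: hadj_diag => i; rewrite mxE invr_ge0 sqrtC_ge0 ltW.
have -> : A + diag_mx d = diag_mx s *m
    (1%:M + diag_mx r *m A *m hadj (diag_mx r)) *m diag_mx s.
  rewrite hr mulmxDr mulmx1 mulmxDl ss addrC; congr (_ + _).
  by rewrite !mulmxA sr mul1mx -mulmxA rs mulmx1.
rewrite !det_mulmx mulrAC -det_mulmx ss det_diag ler_peMr//.
  by apply: prodr_ge0 => i _; rewrite ltW.
exact/psdmx_det1D/psdmx_congr.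
Qed.

(* Hadamard's inequality: after scaling to unit diagonal it is AM-GM for the
   diagonal of the Schur form. *)
Lemma pdmx_det_le_diag n (A : 'M[C]_n) : pdmx A -> \det A <= \prod_i A i i.
Proof.
move=> pA; have A0 i := pdmx_diag i pA.
pose r := \row_i (sqrtC (A i i))^-1.
have r0 i : 0 < r 0 i by rewrite mxE invr_gt0 sqrtC_gt0.
have hr : hadj (diag_mx r) = diag_mx r.
  by apply: hadj_diag => i; rewrite ltW.
pose B := diag_mx r *m A *m hadj (diag_mx r).
have pB : psdmx B by exact/psdmx_congr/pdmx_psd.
have detB : \det B = \det A / \prod_i A i i.
  rewrite /B hr !det_mulmx mulrAC det_diag -big_split/= mulrC -prodfV.
  congr (_ * _); apply: eq_bigr => i _.
  by rewrite mxE -expr2 exprVn sqrtCK.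
have trB : \tr B = n%:R.
  transitivity (\sum_(i < n) (1 : C)); last by rewrite sumr_const card_ord.
  apply: eq_bigr => i _; rewrite /B hr mul_diag_mx mul_mx_diag !mxE.
  by rewrite mulrAC -expr2 exprVn sqrtCK mulVf ?gt_eqF.
have [u [_ dB tB _]] := schur_quad B.
suff : \det B <= 1 by rewrite detB ler_pdivrMr ?mul1r// prodr_gt0.
(* For n = 0 the product is empty. Otherwise the arithmetic mean in AM-GM is tr B / n = 1. *)
have [/eqP|n0] := eqVneq (n%:R : C) 0.
  rewrite pnatr_eq0 dB => /eqP z; rewrite big1// => i _.
  by have := leq_trans (ltn_ord i) (eq_leq z).
have := leif_AGM (A := 'I_n) (E := fun i => (u i *m B *m hadj (u i)) 0 0).
rewrite card_ord /= -tB trB divff// expr1n dB => /(_ _)[]//=.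
Qed.

(** * Determinant bounds for a stacked channel *)

(** Sylvester's identity, from multiplying the same two block matrices in both orders. *)
Lemma det_1DM m n (A : 'M[C]_(m, n)) (B : 'M[C]_(n, m)) :
  \det (1%:M + A *m B) = \det (1%:M + B *m A).
Proof.
have e1 : block_mx 1%:M (- A) B 1%:M *m block_mx 1%:M A 0 1%:M =
   block_mx 1%:M 0 B (1%:M + B *m A).
  rewrite mulmx_block !mulmx1 !mul1mx !mulmx0 !addr0 subrr.
  by rewrite addrC.
have e2 : block_mx 1%:M A 0 1%:M *m block_mx 1%:M (- A) B 1%:M =
   block_mx (1%:M + A *m B) 0 B 1%:M.
  rewrite mulmx_block !mulmx1 !mul1mx !mul0mx !add0r addrC.
  by rewrite addNr.
have := congr1 determinant e1; have := congr1 determinant e2.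
rewrite !det_mulmx !det_lblock !det_ublock !det1 !mul1r !mulr1.
by move=> <- <-.
Qed.


(** [g] and [c] depend on [W] alone, and both bounds share [g]; this is what later makes it
    cancel. *)
Lemma det_stack_bounds n M (W : 'M[C]_(n, M)) : row_free W ->
  exists g c : C, [/\ 0 < g, 0 < c,
    forall Q : 'M[C]_n, psdmx Q ->
      0 < \det (1%:M + hadj W *m Q *m W) <= g * \prod_i (c + Q i i) &
    forall d : 'rV[C]_n, (forall i, 0 < d 0 i) ->
      g * \prod_i d 0 i <= \det (1%:M + hadj W *m diag_mx d *m W)].
Proof.
move=> fW; pose G := W *m hadj W.
have pG : pdmx G by rewrite /G -[W in W *m _]mulmx1; exact/pdmx_congr/pdmx1.
have uG := pdmx_unit pG; have g0 := pdmx_det_gt0 pG.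
have hG : hadj G = G by rewrite /G hadjM hadjK.
have hiG : hadj (invmx G) = invmx G.
  by rewrite /hadj map_invmx trmx_inv -/(hadj G) hG.
have piG : pdmx (invmx G).
  have -> : invmx G = invmx G *m G *m hadj (invmx G).
    by rewrite hiG mulVmx// mul1mx.
  by apply: pdmx_congr => //; rewrite row_free_unit unitmx_inv.
have detE Q : \det (1%:M + hadj W *m Q *m W) = \det G * \det (invmx G + Q).
  rewrite -mulmxA det_1DM -mulmxA -/G mulrC -det_mulmx mulmxDl mulVmx//.
(* The trace dominates each diagonal entry of G^-1, all of them being positive; the added 1 keeps
   [c] positive even for n = 0. *)
exists (\det G), (1 + \sum_i invmx G i i); split=> //.
- by rewrite ltr_pwDl// sumr_ge0// => i _; rewrite ltW// pdmx_diag.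
- move=> Q pQ; have pGQ := pdmxD piG pQ.
  rewrite detE mulr_gt0 ?pdmx_det_gt0//= ler_pM2l//.
  apply: le_trans (pdmx_det_le_diag pGQ) _.
  apply: ler_prod => i _; rewrite ltW ?pdmx_diag//= mxE lerD2r (bigD1 i)//=.
  rewrite addrCA lerDl addr_ge0// sumr_ge0// => j _.
  by rewrite ltW// pdmx_diag.
- move=> d d0; rewrite detE ler_pM2l//.
  exact: psdmx_detD_diag (pdmx_psd piG) d0.
Qed.

(** * Block-diagonal covariances and the matrices A^(k) *)

Lemma mxdiag_entry K (p : 'I_K -> nat) (Q : forall k, 'M[C]_(p k)) k i :
  (\mxdiag_k Q k) (tagnat.Rank k i) (tagnat.Rank k i) = Q k i i.
Proof.
have := submxblock_diag Q k => /matrixP/(_ i i) <-; by rewrite !mxE.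
Qed.

Lemma prod_mxdiag K (p : 'I_K -> nat) (F : 'I_(\sum_k p k) -> C) :
  \prod_i F i = \prod_k \prod_i F (tagnat.Rank k i).
Proof.
rewrite sig_big_dep/= (reindex _ tagnat.sig_bij_on)/=.
by apply: eq_bigr => l _; rewrite (tagnat.sig2K l).
Qed.

Lemma hadj_mxcol K (p : 'I_K -> nat) M (H : forall k, 'M[C]_(p k, M)) :
  hadj (\mxcol_k H k) = \mxrow_k hadj (H k).
Proof. by rewrite -tr_mxcol; congr _^T; apply/matrixP => i j; rewrite !mxE. Qed.

Lemma psdmx_mxdiag K (p : 'I_K -> nat) (Q : forall k, 'M[C]_(p k)) :
  (forall k, psdmx (Q k)) -> psdmx (\mxdiag_k Q k).
Proof.
move=> pQ v; rewrite -[v]submxrowK mul_mxrow_mxdiag.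
rewrite [hadj _](_ : _ = \mxcol_k hadj (submxrow v k)).
  rewrite mul_mxrow_mxcol summxE sumr_ge0// => k _; exact: pQ.
by rewrite -tr_mxrow; congr _^T; apply/matrixP => i j; rewrite !mxE.
Qed.

(** A left kernel vector of the first k blocks, padded with zeros, is one of the full stack. *)
Lemma row_free_mxcol_widen k K N M (H : 'I_K -> 'M[C]_(N, M)) (kK : (k <= K)%N) :
  row_free (\mxcol_j H j) -> row_free (\mxcol_(j < k) H (widen_ord kK j)).
Proof.
move=> fH; apply: inj_row_free => v v0.
(* [insub] fails for j >= k, where the default 0 does the padding. *)
pose w (j : 'I_K) : 'rV[C]_N := oapp (submxrow v) 0 (insub (j : nat)).
have wE i : w (widen_ord kK i) = submxrow v i.
  by rewrite /w /= insubT//= => ik; congr submxrow; exact: val_inj.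
suff w0 : \mxrow_j w j = 0.
  rewrite -[v]submxrowK; apply/eqP; rewrite -[X in _ == X](@mxrow0 C k (fun=> N) 1).
  apply/eqP/eq_mxrow => i; rewrite -wE.
  by rewrite -(mxrowK w) w0 submxrow0.
apply: (row_free_inj fH); rewrite mul0mx mul_mxrow_mxcol -[RHS]v0.
rewrite -[in RHS](submxrowK v) mul_mxrow_mxcol.
rewrite (bigID (fun j : 'I_K => (j < k)%N))/= [X in _ + X]big1 ?addr0.
  by rewrite (big_ord_narrow kK); apply: eq_bigr => i _; rewrite wE.
by move=> i ik; rewrite /w insubF ?mul0mx//; apply/negbTE.
Qed.

(** The stacked bounds, read over the reals. The lower bound asks positive power of the first k
    users only, since later users may have weight zero and hence no power. *)
Lemma Amx_bounds K N M (H : 'I_K -> 'M[C]_(N, M)) k : (k <= K)%N ->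
  row_free (stackH H) ->
  exists g c : R, [/\ 0 < g, 0 < c,
    forall Q, (forall j, psdmx (Q j)) ->
      0 < complex.Re (\det (Amx H Q k)) <=
      g * \prod_(j < K | (j < k)%N) \prod_i (c + complex.Re (Q j i i)) &
    forall q : 'I_K -> R, (forall j : 'I_K, (j < k)%N -> 0 < q j) ->
      g * \prod_(j < K | (j < k)%N) q j ^+ N <=
      complex.Re (\det (Amx H (fun j => (real_complex R (q j))%:M) k))].
Proof.
move=> kK fH; pose H' (j : 'I_k) := H (widen_ord kK j).
have AmxE Q : Amx H Q k = 1%:M + hadj (\mxcol_j H' j) *m
    (\mxdiag_j Q (widen_ord kK j)) *m \mxcol_j H' j.
  rewrite /Amx (big_ord_narrow kK) hadj_mxcol mul_mxrow_mxdiag mul_mxrow_mxcol.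
  by [].
have [g [c [g0 c0 upper lower]]] := det_stack_bounds (row_free_mxcol_widen kK fH).
have gE : g = real_complex R (complex.Re g) by rewrite RRe_real// gtr0_real.
have cE : c = real_complex R (complex.Re c) by rewrite RRe_real// gtr0_real.
exists (complex.Re g), (complex.Re c); split.
- by move: g0; rewrite gE ltcR.
- by move: c0; rewrite cE ltcR.
- move=> Q pQ.
  have := upper _ (psdmx_mxdiag (fun j : 'I_k => pQ (widen_ord kK j))).
  rewrite -AmxE => /andP[d0].
  rewrite prod_mxdiag (eq_bigr (fun j : 'I_k => real_complex R
     (\prod_i (complex.Re c + complex.Re (Q (widen_ord kK j) i i))))).
    rewrite -rmorph_prod {1}gE -rmorphM.
    rewrite -[X in X <= _]RRe_real ?gtr0_real// lecR => dle.
    rewrite (big_ord_narrow kK) dle andbT; by move: d0; rewrite ltcE => /andP[].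
  move=> j _; rewrite rmorph_prod; apply: eq_bigr => i _.
  rewrite mxdiag_entry {1}cE rmorphD; congr (_ + _).
  exact/esym/RRe_real/ger0_real/psdmx_diag.
- move=> q q0.
  pose r (j : 'I_k) : 'rV[C]_N := const_mx (real_complex R (q (widen_ord kK j))).
  have rE j i : (\mxrow_j r j) 0 (tagnat.Rank j i) = r j 0 i.
    by rewrite -[in RHS](mxrowK r j) !mxE.
  have r0 i : 0 < (\mxrow_j r j) 0 i by rewrite !mxE ltcR q0//= ltn_ord.
  have := lower _ r0; rewrite diag_mxrow prod_mxdiag.
  under eq_mxdiag => j do rewrite diag_const_mx.
  rewrite -(AmxE (fun j => (real_complex R (q j))%:M)).
  rewrite (eq_bigr (fun j : 'I_k => real_complex R (q (widen_ord kK j) ^+ N))).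
    rewrite -rmorph_prod {1}gE -rmorphM lecE => /andP[_].
    by rewrite (big_ord_narrow kK).
  move=> j _; rewrite rmorphXn -[N in RHS]card_ord -prodr_const.
  by apply: eq_bigr => i _; rewrite rE mxE.
Qed.

(** * Logarithmic bounds and summation by parts *)

Lemma ln_prod (I : finType) (P : pred I) (F : I -> R) :
  (forall i, P i -> 0 < F i) -> ln (\prod_(i | P i) F i) = \sum_(i | P i) ln (F i).
Proof.
(* Positivity of the partial products travels with the induction because [lnM] needs it. *)
move=> F0; suff [] : 0 < \prod_(i | P i) F i /\
  ln (\prod_(i | P i) F i) = \sum_(i | P i) ln (F i) by [].
elim/big_ind2: _ => [|x a y b [x0 <-] [y0 <-]|i Pi]; rewrite ?ln1//.
  by rewrite mulr_gt0// lnM.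
by rewrite F0.
Qed.

Lemma ln_det_Amx_bounds K N M (H : 'I_K -> 'M[C]_(N, M)) k : (k <= K)%N ->
  row_free (stackH H) ->
  exists p : R * R, [/\ 0 < p.2,
    forall Q, (forall j, psdmx (Q j)) -> ln (complex.Re (\det (Amx H Q k))) <=
      p.1 + \sum_(j < K | (j < k)%N) \sum_i ln (p.2 + complex.Re (Q j i i)) &
    forall q : 'I_K -> R, (forall j : 'I_K, (j < k)%N -> 0 < q j) ->
      p.1 + \sum_(j < K | (j < k)%N) ln (q j) *+ N <=
      ln (complex.Re (\det (Amx H (fun j => (real_complex R (q j))%:M) k)))].
Proof.
move=> kK fH; have [g [c [g0 c0 upper lower]]] := Amx_bounds kK fH.
exists (ln g, c); split=> //= [Q pQ|q q0].
- have F0 j i : 0 < c + complex.Re (Q j i i).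
    by rewrite ltr_pwDl//; have := psdmx_diag i (pQ j); rewrite lecE => /andP[].
  have FF0 j : 0 < \prod_i (c + complex.Re (Q j i i)) by rewrite prodr_gt0.
  have /andP[D0 Dle] := upper Q pQ.
  rewrite (eq_bigr (fun j => ln (\prod_i (c + complex.Re (Q j i i))))).
    rewrite -ln_prod// -lnM ?posrE ?prodr_gt0// ler_ln ?posrE//.
    by rewrite mulr_gt0// prodr_gt0.
  by move=> j _; rewrite ln_prod.
- rewrite (eq_bigr (fun j => ln (q j ^+ N))); last first.
    by move=> j jk; rewrite lnXn// q0.
  have P0 : 0 < \prod_(j < K | (j < k)%N) q j ^+ N.
    by apply: prodr_gt0 => j jk; rewrite exprn_gt0// q0.
  rewrite -ln_prod => [|j jk]; last by rewrite exprn_gt0// q0.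
  have le := lower q q0.
  have g1 : 0 < g * \prod_(j < K | (j < k)%N) q j ^+ N by rewrite mulr_gt0.
  by rewrite -lnM ?posrE// ler_ln ?posrE// (lt_le_trans g1).
Qed.

(* Summation by parts; the induction proves that the sum is at least its
   boundary term [m n.-1 * h n]. *)
Lemma nonincr_weights_sum_ge0 (m h : nat -> R) n :
  (forall k, 0 <= m k) -> {homo m : i j / (i <= j)%N >-> j <= i} -> h 0%N = 0 ->
  (forall k, (k < n)%N -> 0 < m k -> 0 <= h k.+1) ->
  0 <= \sum_(k < n) m k * (h k.+1 - h k).
Proof.
move=> m0 mle h0 hge.
have mh k : (k < n)%N -> 0 <= m k * h k.+1.
  move=> kn; have := m0 k; rewrite le0r => /orP[/eqP ->|mk].
    by rewrite mul0r.
  by rewrite mulr_ge0// hge.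
case: n => [|n] in hge mh *; first by rewrite big_ord0.
apply: le_trans (mh n (ltnSn n)) _.
elim: n => [|n IHn] in hge mh *.
  by rewrite big_ord_recl big_ord0 addr0 h0 subr0.
rewrite big_ord_recr /= mulrBr addrCA lerDl subr_ge0.
apply: le_trans (IHn _ _) => [|k kn|k kn]; last 2 first.
- by apply: hge; rewrite ltnW.
- by apply: mh; rewrite ltnW.
(* If [m n] vanishes, so does [m n.+1] by monotonicity; otherwise [h n.+1] is nonnegative and the
   larger weight wins. *)
have := m0 n; rewrite le0r => /orP[/eqP z|mn].
  have z' : m n.+1 = 0 by apply/eqP; rewrite eq_le m0 andbT -z mle.
  by rewrite z z' !mul0r.
by rewrite ler_wpM2r ?mle// hge// ltnW.
Qed.

(** * The rate gap at finite power *)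

Lemma rateDPCE K N M (mu : 'I_K -> R) (H : 'I_K -> 'M[C]_(N, M)) Q :
  row_free (stackH H) -> (forall k, psdmx (Q k)) ->
  rateDPC mu H Q = (\sum_(k < K) mu k * (ln (complex.Re (\det (Amx H Q k.+1))) -
                      ln (complex.Re (\det (Amx H Q k))))) / ln 2.
Proof.
move=> fH pQ; rewrite mulr_suml; apply: eq_bigr => k _.
have D0 l : (l <= K)%N -> 0 < complex.Re (\det (Amx H Q l)).
  by move=> lK; have [g [c [_ _ /(_ Q pQ)/andP[]]]] := Amx_bounds lK fH.
by rewrite /log2 ln_div ?posrE ?D0 ?mulrA// ltnW.
Qed.

Lemma scalar_psdmx N (q : R) : 0 <= q -> psdmx ((real_complex R q)%:M : 'M[C]_N).
Proof.
move=> q0 v; rewrite -mulmxA mul_scalar_mx -scalemxAr mxE.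
rewrite mulr_ge0 ?lecR//.
by have := pdmx_psd (@pdmx1 N) v; rewrite mulmx1.
Qed.

Lemma equal_power_feasible K N (mu : 'I_K -> R) P : (0 < N)%N -> 0 <= P ->
  (forall k, 0 <= mu k) -> \sum_k mu k = 1 ->
  feasibleDPC P (fun k => (real_complex R (mu k * P / N%:R))%:M : 'M[C]_N).
Proof.
move=> N0 P0 mu0 mu1; split=> [k|].
  by apply: scalar_psdmx; rewrite divr_ge0// mulr_ge0.
rewrite (eq_bigr (fun k => real_complex R (mu k * P))).
  by rewrite -rmorph_sum -mulr_suml mu1 mul1r.
move=> k _; rewrite mxtrace_scalar -rmorphMn -mulr_natr /= divfK//.
by rewrite pnatr_eq0 -lt0n.
Qed.

(** [B] is uniform in both the power and the competing allocation, so the bound survives the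
    supremum and then the limit. *)
Lemma rateDPC_gap K N M (H : 'I_K -> 'M[C]_(N, M)) (mu : 'I_K -> R) :
  (0 < N)%N -> row_free (stackH H) ->
  (forall i j : 'I_K, (i <= j)%N -> mu j <= mu i) ->
  (forall k, 0 <= mu k) -> \sum_(k < K) mu k = 1 ->
  exists B : R, forall P, 0 < P -> forall Q, feasibleDPC P Q ->
    rateDPC mu H Q <=
      rateDPC mu H (fun k => (real_complex R (mu k * P / N%:R))%:M) + B / P.
Proof.
move=> N0 fH mule mu0 mu1.
have Nr : 0 < N%:R :> R by rewrite ltr0n.
have [p hp] := choice (fun k : 'I_K => ln_det_Amx_bounds (ltn_ord k) fH).
(* One constant for all k, so that the terms [s j] below do not depend on k. *)
pose c : R := 1 + \sum_k (p k).2.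
have p0 k : 0 < (p k).2 by have [] := hp k.
have pc k : (p k).2 <= c.
  rewrite /c (bigD1 k)//= addrCA lerDl addr_ge0// sumr_ge0// => j _.
  exact: ltW.
have c0 : 0 < c by rewrite ltr_pwDl// sumr_ge0// => j _; exact: ltW.
exists (K%:R * N%:R ^+ 2 * c / ln 2) => P P0 Q fQ.
have [pQ trQ] := fQ.
pose q k := mu k * P / N%:R; pose Q' k : 'M[C]_N := (real_complex R (q k))%:M.
have [pQ' _] := equal_power_feasible N0 (ltW P0) mu0 mu1.
have Q0 j i : 0 <= complex.Re (Q j i i).
  by have := psdmx_diag i (pQ j); rewrite lecE => /andP[].
have cQ j i : 0 < c + complex.Re (Q j i i) by rewrite ltr_pwDl.
pose s j := \sum_(i < N) (ln (c + complex.Re (Q j i i)) - ln (q j)).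
(* Extension of [mu] by 0 to all naturals; it stays nonincreasing because [mu] is nonnegative. *)
pose m k := oapp mu 0 (insub k).
have mE (k : 'I_K) : m k = mu k by rewrite /m valK.
pose L Q k := ln (complex.Re (\det (Amx H Q k))).
(* Slack in the bound on the log-determinant gap after k users. *)
pose h k := \sum_(j < K | (j < k)%N) s j - (L Q k - L Q' k).
have abel : 0 <= \sum_(k < K) m k * (h k.+1 - h k).
  apply: nonincr_weights_sum_ge0.
  - by move=> k; rewrite /m; case: insubP => //=.
  - move=> i j ij; rewrite /m; case: insubP => [j' _ <-|jK]/= in ij *.
      have iK : (i < K)%N by exact: leq_ltn_trans (ltn_ord j').
      by rewrite insubT/=; exact: mule.
    by case: insubP => //=.
  (* Both allocations have A^(0) = I. *)
  - rewrite /h big1//.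
    rewrite /L /Amx !big1//; by [rewrite !subrr | ].
  (* A positive weight at k forces positive power for every earlier user, as the lower bound
     requires. Subtracting the two bounds cancels the common term [(p k).1]. *)
  - move=> k kK; rewrite -[k]/(val (Ordinal kK)) mE => muk.
    have [_ upper lower] := hp (Ordinal kK).
    have q0 (j : 'I_K) : (j < k.+1)%N -> 0 < q j.
      move=> jk; rewrite divr_gt0// mulr_gt0//.
      exact: lt_le_trans muk (mule j (Ordinal kK) jk).
    have := lerB (upper Q pQ) (lower q q0); rewrite /= => le.
    rewrite subr_ge0; apply: le_trans le _.
    rewrite opprD addrACA subrr add0r -sumrB ler_sum// => j _.
    rewrite /s sumrB sumr_const card_ord lerB// ler_sum// => i _.
    by rewrite ler_ln ?posrE ?lerD2r// ltr_pwDl.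
have hS (k : 'I_K) : h k.+1 - h k = s k - (L Q k.+1 - L Q k) + (L Q' k.+1 - L Q' k).
  rewrite /h (bigD1 k)//=.
  rewrite (eq_bigl (fun j : 'I_K => (j < k)%N)).
    move: (s k) (\sum_(j < K | _) _) (L Q k.+1) (L Q k) (L Q' k.+1) (L Q' k).
    by move=> *; ring.
  by move=> j; rewrite ltnS leq_eqVlt -val_eqE; case: ltngtP.
(* The choice of [q j] gives mu_j / q_j = N / P, so in ln y <= y - 1 the weight drops out of the
   main term. *)
have mus j : mu j * s j <=
    \sum_(i < N) ((c + complex.Re (Q j i i)) * N%:R / P - mu j).
  rewrite mulr_sumr ler_sum// => i _.
  have := mu0 j; rewrite le0r => /orP[/eqP ->|muj].
    by rewrite mul0r subr0 divr_ge0 ?mulr_ge0// ltW.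
  have qj : 0 < q j by rewrite divr_gt0// mulr_gt0.
  rewrite -ln_div ?posrE//.
  have lny (y : R) : 0 < y -> ln y <= y - 1.
    by move=> y0; rewrite -[leLHS](congr1 _ (subrKC 1 y)) le_ln1Dx// ltrBrDl subrr.
  apply: le_trans (ler_wpM2l (ltW muj) (lny _ (divr_gt0 (cQ j i) qj))) _.
  rewrite le_eqVlt; apply/orP; left; apply/eqP; rewrite /q; field.
  by rewrite !gt_eqF.
have sums : \sum_j mu j * s j <= K%:R * N%:R ^+ 2 * c / P.
  apply: le_trans (ler_sum _ (fun j _ => mus j)) _.
  (* The summed bound is (N / P) (K N c + sum of the [T j]) - N; the trace constraint lets the -N
     absorb the traces. *)
  pose T j := \sum_(i < N) complex.Re (Q j i i).
  have TP : \sum_j T j <= P.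
    move: trQ; rewrite lecE => /andP[_]; rewrite /= raddf_sum.
    by rewrite (eq_bigr T) // => j _; exact: raddf_sum.
  rewrite (eq_bigr (fun j => N%:R / P * (N%:R * c + T j) - N%:R * mu j)).
    rewrite sumrB -!mulr_sumr mu1 big_split/= sumr_const card_ord -mulr_natl.
    rewrite -subr_ge0 (_ : _ - _ = N%:R / P * (P - \sum_j T j)).
      by rewrite mulr_ge0 ?subr_ge0// divr_ge0// ltW.
    by field; rewrite gt_eqF.
  move=> j _; rewrite sumrB -!mulr_suml big_split/= !sumr_const card_ord.
  rewrite -[c *+ N]mulr_natl -[mu j *+ N]mulr_natl /T; ring.
rewrite !rateDPCE// -/Q' [_ / ln 2 / P]mulrAC -mulrDl.
rewrite ler_pM2r ?invr_gt0 ?ln_gt0 ?ltr1n//.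
(* What remains is [abel], expanded by [hS]. *)
apply: le_trans (lerD (lexx _) sums).
rewrite -big_split/= -subr_ge0 -sumrB.
move: abel; rewrite (eq_bigr _ (fun k _ => congr2 *%R (mE k) (hS k))).
congr (_ <= _); apply: eq_bigr => k _.
rewrite -/(L Q k.+1) -/(L Q k) -/(L Q' k.+1) -/(L Q' k).
by move: (s k) (L Q k.+1) (L Q k) (L Q' k.+1) (L Q' k) => *; ring.
Qed.

End HighSNR.

(** * Passage to the limit *)

Theorem theorem8 (R : realType) (K N M : nat) (H : 'I_K -> 'M[R[i]]_(N, M))
    (mu : 'I_K -> R) :
  (1 <= K)%N -> (1 <= N)%N -> (K * N <= M)%N ->
  row_free (stackH H) ->
  (forall i j : 'I_K, (i <= j)%N -> mu j <= mu i) ->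
  (forall k, 0 <= mu k) ->
  \sum_(k < K) mu k = 1 ->
  (capDPC mu H P - rateDPC mu H (fun k => (real_complex R (mu k * P / N%:R))%:M))
    @[P --> +oo] --> (0 : R).
Proof.
move=> _ N0 _ fH mule mu0 mu1.
have [B gap] := rateDPC_gap N0 fH mule mu0 mu1.
have BP : B / P @[P --> +oo] --> (0 : R).
  rewrite -[X in _ --> X](mulr0 B); apply: cvgM; first exact: cvg_cst.
  apply/gtr0_cvgV0; last exact: cvg_id.
  exact: nbhs_pinfty_gt.
(* The gap lies between 0, by feasibility of the proposed allocation, and B / P. *)
apply: (squeeze_cvgr _ (cvg_cst 0) BP).
near=> P; have P0 : 0 < P by near: P; exact: nbhs_pinfty_gt.
set r := rateDPC _ _ _.
have Er : [set r | exists Q : 'I_K -> 'M[R[i]]_N,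
    feasibleDPC P Q /\ r = rateDPC mu H Q] r.
  by eexists; split; first exact: (equal_power_feasible N0 (ltW P0) mu0 mu1).
(* Used twice: it makes the set bounded, so that [sup] is a true supremum, and it bounds that
   supremum. *)
have ubE : ubound [set r | exists Q : 'I_K -> 'M[R[i]]_N,
    feasibleDPC P Q /\ r = rateDPC mu H Q] (r + B / P).
  by move=> _ [Q [fQ ->]]; exact: gap.
rewrite subr_ge0 lerBlDl; apply/andP; split.
  by apply: ub_le_sup Er; exists (r + B / P).
by apply: ge_sup => //; exists r.
Unshelve. all: by end_near.
Qed.
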